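(* Let $t$ be a positive integer. Then for all $n\ge 0$, $p_{t,t}(n)\equiv \overline{C}_{4t,t}(n) \pmod 2$.
   Context: For a partition $\lambda$ and positive integers $A,a$, $\mathrm{mex}_{A,a}(\lambda)$ is the smallest positive integer congruent to $a$ modulo $A$ that is not a part of $\lambda$; $p_{A,a}(n)$ is the number of partitions $\lambda$ of $n$ with $\mathrm{mex}_{A,a}(\lambda)\equiv a \pmod{2A}$. An overpartition of $n$ is a non-increasing sequence of positive integers summing to $n$ in which the first occurrence of each distinct number may be overlined. For $k\ge3$ and $1\le i\le \lfloor k/2\rfloor$, Andrews' singular overpartition function $\overline{C}_{k,i}(n)$ counts overpartitions of $n$ in which no part is divisible by $k$ and only parts congruent to $\pm i \pmod k$ may be overlined; equivalently $\sum_{n\ge0}\overline{C}_{k,i}(n)q^n=\frac{(q^k;q^k)_\infty(-q^i;q^k)_\infty(-q^{k-i};q^k)_\infty}{(q;q)_\infty}$, where $(x;q)_\infty=\prod_{j\ge0}(1-xq^j)$. *)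

(* Defs.v *)
From mathcomp Require Import all_boot.

Set Implicit Arguments.
Unset Strict Implicit.
Unset Printing Implicit Defensive.

Definition is_partition (n : nat) (s : seq nat) : bool :=
  [&& sorted geq s, all (leq 1) s & sumn s == n].

Lemma leq_sumn_mem (s : seq nat) (m : nat) : m \in s -> m <= sumn s.
Proof.
elim: s => //= m' s IHs; rewrite inE => /predU1P[->|/IHs le_m].
  exact: leq_addr.
exact: leq_trans le_m (leq_addl _ _).
Qed.

(* A partition of n has at most n parts, each of them at most n. Hence          *)
(* partitions of n may be counted inside the finite type n.-bseq 'I_n.+1, and    *)
(* overpartitions of n inside n.-bseq ('I_n.+1 * bool).                          *)
Lemma is_partition_bound (n : nat) (s : seq nat) :
  is_partition n s -> size s <= n /\ all (fun m => m < n.+1) s.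
Proof.
case/and3P=> _ pos_s /eqP <-; split.
  elim: s pos_s => //= m s IHs /andP[m_gt0 /IHs].
  by rewrite -add1n; apply: leq_add.
by apply/allP=> m s_m; rewrite ltnS; apply: leq_sumn_mem.
Qed.

Definition mex_candidate (A a : nat) (s : seq nat) : pred nat :=
  fun m => [&& 0 < m, m == a %[mod A] & m \notin s].

Lemma mex_candidate_ex (A a : nat) (s : seq nat) :
  0 < A -> exists m, mex_candidate A a s m.
Proof.
move=> A_gt0; exists (a + (sumn s).+1 * A).
have lt_s : sumn s < a + (sumn s).+1 * A.
  by apply: leq_trans (leq_addl _ _); apply: leq_pmulr.
apply/and3P; split; first exact: leq_ltn_trans lt_s.
  by rewrite addnC modnMDl.
apply/negP=> s_m; move: lt_s; rewrite ltnNge => /negP[].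
exact: leq_sumn_mem.
Qed.

Definition mex (A a : nat) (A_gt0 : 0 < A) (s : seq nat) : nat :=
  ex_minn (mex_candidate_ex a s A_gt0).

Definition p_mex (A a : nat) (A_gt0 : 0 < A) (n : nat) : nat :=
  #|[set s : n.-bseq 'I_n.+1 |
      is_partition n (map val s)
      && (mex a A_gt0 (map val s) == a %[mod 2 * A])]|.

Arguments p_mex : clear implicits.

(* In an overpartition, (m, true) is an overlined part m and (m, false) a        *)
(* non-overlined one.                                                            *)
Definition is_overpartition (n : nat) (s : seq (nat * bool)) : bool :=
  is_partition n (unzip1 s) &&
  [forall j : 'I_(size s),
     (nth (0, false) s j).2 ==>
       ((nth (0, false) s j).1 \notin take j (unzip1 s))].

(* k %| m + i expresses m = - i mod k.                                           *)
Definition is_singular (k i : nat) (s : seq (nat * bool)) : bool :=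
  all (fun x => ~~ (k %| x.1)) s &&
  all (fun x => x.2 ==> ((x.1 == i %[mod k]) || (k %| x.1 + i))) s.

Definition Cbar (k i n : nat) : nat :=
  #|[set s : n.-bseq ('I_n.+1 * bool) |
      let s' := [seq (val x.1, x.2) | x <- s] in
      is_overpartition n s' && is_singular k i s']|.

(* Main.v *)
Require Import Defs.
From mathcomp Require Import all_boot all_order all_algebra.
From mathcomp Require Import ring zify.

Set Implicit Arguments.
Unset Strict Implicit.
Unset Printing Implicit Defensive.
Import GRing.Theory.


(** With T_j = j(j+1)/2, a partition with mex_{t,t} = (m+1)t contains
    t, 2t, ..., jt exactly for j <= m, so p_{t,t}(n) has the parity of the number
    of pairs (j, lambda) with t, 2t, ..., jt all parts of lambda; hence its
    generating series is (sum_j q^(t T_j)) / (q; q) modulo 2. Modulo 2 that of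
    Cbar_{4t,t} is prod_j (1 - q^(t(2j+1))) (1 - q^(t(4j+4))) / (q; q). The two
    numerators agree modulo 2 because, after multiplication by
    prod_j (1 - q^(t(2j+1))), both become prod_j (1 - q^(t(2j+2))): for the sum
    this is Gauss' identity, in the finite form of Shanks, and for the product it
    is (1 - a)^2 = 1 - a^2 in characteristic 2. Series are handled as polynomials
    over F_2 modulo X^(n+1). *)

(** * Generating polynomials of sorted words with constrained multiplicities *)

Lemma count_flatten_nseq (T : finType) (f : T -> nat) (x : T) :
  count_mem x (flatten [seq nseq (f y) y | y <- enum T]) = f x.
Proof.
rewrite count_flatten -map_comp sumnE big_map big_enum /= (bigD1 x) //=.
rewrite count_nseq /= eqxx mul1n big1 ?addn0 // => y /negPf y_neq_x.
by rewrite count_nseq /= y_neq_x.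
Qed.

Lemma sumn_map_count (T : finType) (w : T -> nat) (s : seq T) :
  sumn (map w s) = \sum_x w x * count_mem x s.
Proof.
elim: s => [|y s IHs] /=; first by rewrite big1 // => x _; rewrite muln0.
under eq_bigr => x _ do rewrite mulnDr.
rewrite big_split /= -IHs; congr addn.
rewrite (bigD1 y) //= eqxx muln1 big1 ?addn0 // => x.
by rewrite eq_sym => /negPf->; rewrite muln0.
Qed.

Section CountSorted.

Variables (T : finType) (r : rel T) (w : T -> nat) (c : T -> nat -> bool).
Variable n : nat.
Hypotheses (r_total : total r) (r_trans : transitive r).
Hypothesis r_anti : antisymmetric r.
Hypothesis c_weight0 : forall x k, c x k -> w x = 0 -> k = 0.

Definition sorted_words : {set n.-bseq T} :=
  [set s : n.-bseq T | [&& sorted r s, sumn (map w s) == n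
                         & [forall x, c x (count_mem x s)]]].

Definition multiplicities : {set {ffun T -> 'I_n.+1}} :=
  [set f : {ffun T -> 'I_n.+1} |
    (f \in family (fun x k => c x (val k))) && (\sum_x w x * f x == n)].

(** Antisymmetry leaves one sorted arrangement per family of multiplicities, so counting letters is
    injective; sorting a word with [f x] copies of each [x] inverts it. *)
Lemma card_sorted_words : #|sorted_words| = #|multiplicities|.
Proof.
pose mult (s : n.-bseq T) := [ffun x => inord (count_mem x s) : 'I_n.+1].
have multE s x : mult s x = count_mem x s :> nat.
  rewrite ffunE inordK // ltnS (leq_trans (count_size _ _)) //.
  exact: size_bseq.
rewrite -(@card_in_imset _ _ mult); last first.
  move=> s1 s2; rewrite !inE => /andP[s1_sorted _] /andP[s2_sorted _] eq_mult.
  apply/val_inj/(sorted_eq r_trans r_anti) => //.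
  by apply/allP=> x _ /=; rewrite -!multE eq_mult.
apply: eq_card => f; apply/imsetP/idP => [[s + ->]|].
  rewrite !inE => /and3P[_ /eqP sum_s /forallP c_s].
  apply/andP; split; first by apply/familyP=> x; rewrite unfold_in /= multE.
  by rewrite -[X in _ == X]sum_s sumn_map_count; under eq_bigr do rewrite multE.
rewrite inE => /andP[/familyP c_f /eqP sum_f].
pose s := sort r (flatten [seq nseq (f x) x | x <- enum T]).
have count_s x : count_mem x s = f x.
  by rewrite (permP (permEl (perm_sort _ _))) count_flatten_nseq.
(* By [c_weight0] every letter used has weight at least 1, so the length is at most the weighted sum
   [n]. *)
have size_s : size s <= n.
  rewrite -sum1_size -(big_map (fun=> 1) predT id) -sumnE sumn_map_count -sum_f.
  apply: leq_sum => x _; rewrite count_s mul1n.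
  have := c_f x; rewrite unfold_in => /c_weight0.
  by case: (w x) => [->|m _] //; apply: leq_pmull.
exists (Bseq size_s).
  2: by apply/ffunP=> x; apply/ord_inj; rewrite multE /= count_s.
rewrite inE /= sort_sorted // sumn_map_count.
under eq_bigr do rewrite count_s.
rewrite sum_f eqxx; apply/forallP=> x; rewrite count_s.
exact: c_f.
Qed.

(** Expanding the product picks one multiplicity per letter, and the exponents add up to the
    weighted sum. *)
Lemma card_sorted_words_coef (R : comNzRingType) :
  (#|sorted_words|%:R = (\prod_x \sum_(k < n.+1 | c x k) 'X^(w x * k))`_n :> R)%R.
Proof.
rewrite card_sorted_words bigA_distr_big_dep coef_sum.
rewrite -sum1dep_card natr_sum big_mkcondr /=.
apply: eq_bigr => f _; rewrite prodrXr coefXn eq_sym.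
by case: eqP.
Qed.

End CountSorted.

(** * Shanks' finite form of Gauss' triangular number identity *)

Section Shanks.
Local Open Scope ring_scope.
Variables (R : comNzRingType) (q : R).

Definition odd_prod n := \prod_(0 <= j < n) (1 - q ^+ (j * 2).+1).
Definition even_prod s n := \prod_(s <= j < n) (1 - q ^+ (j * 2).+2).

(** On the right every term with [s > 0] is divisible by [q ^+ (n * 2).+1], so modulo that power
    only the even product remains, as in Gauss' identity. The induction step telescopes. *)
Lemma shanks_identity n :
  odd_prod n * \sum_(0 <= s < (n * 2).+1) q ^+ 'C(s.+1, 2) =
  \sum_(0 <= s < n.+1) even_prod s n * odd_prod s * q ^+ (s * (n * 2).+1).
Proof.
elim: n => [|n IHn].
  by rewrite !big_nat1 /odd_prod /even_prod !big_geq // !mul1r.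
(* The s-th terms at ranks n.+1 and n differ, up to 1 - q^(2n+1), by G s.+1 - G s. *)
pose G s := if s is s'.+1
  then even_prod s' n * odd_prod s * q ^+ (s * (n * 2).+1) else 0.
rewrite mulSn !addSn add0n.
rewrite big_nat_recr // big_nat_recr //= !mulrDr -addrA.
rewrite [X in X * \sum_(_ <= _ < _) _ + _]/odd_prod big_nat_recr //= -/(odd_prod n).
rewrite mulrAC IHn mulr_suml.
rewrite [RHS]big_nat_recr //= [even_prod n.+1 _]/even_prod.
rewrite [\prod_(n.+1 <= _ < _) _]big_geq // mul1r.
(* Of the two new triangular terms, the last matches the term [s = n.+1] on the right, and the other
   one becomes [G n.+1]. *)
have -> : 'C((n * 2).+3, 2) = (n.+1 * (n * 2).+3)%N by rewrite bin2; lia.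
have -> : 'C((n * 2).+2, 2) = (n.+1 * (n * 2).+1)%N by rewrite bin2; lia.
rewrite addrA; congr (_ + _).
apply/eqP; rewrite addrC eq_sym -subr_eq -sumrB; apply/eqP.
rewrite [RHS](_ : _ = G n.+1 - G 0%N); last first.
  by rewrite subr0 /G /even_prod [X in X * _ * _]big_geq // mul1r.
rewrite -telescope_sumr //; apply: eq_big_nat => s /andP[_ s_le_n].
have evenS : even_prod s n.+1 = even_prod s n * (1 - (q ^+ n) ^+ 2 * q ^+ 2).
  by rewrite /even_prod big_nat_recr //= -exprM -exprD addn2.
have oddS : odd_prod s.+1 = odd_prod s * (1 - (q ^+ s) ^+ 2 * q).
  by rewrite /odd_prod big_nat_recr //= -exprM -exprSr.
(* The first factor of [even_prod s.-1 n] is [1 - q ^+ (s * 2)]; it vanishes at [s = 0], so the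
   formula also covers the default value of [G]. *)
have GE : G s = (1 - (q ^+ s) ^+ 2) * even_prod s n * odd_prod s * q ^+ (s * (n * 2).+1).
  case: s s_le_n {evenS oddS} => [|s] s_le_n; first by rewrite expr1n subrr !mul0r.
  by rewrite /G [even_prod s n]/even_prod big_ltn // -exprM.
rewrite GE /G evenS oddS.
have -> : (s * (n * 2).+3 = s * (n * 2).+1 + s * 2)%N by lia.
have -> : (s.+1 * (n * 2).+1 = s * (n * 2).+1 + (n * 2).+1)%N by lia.
rewrite !exprD !exprM [q ^+ (n * 2).+1]exprSr exprM.
set a := q ^+ s; set b := q ^+ n; set d := (a ^+ _).
ring.
Qed.

End Shanks.

(** * Congruence of polynomials modulo a power of ['X] *)

Section CongruenceModX.
Local Open Scope ring_scope.
Variables (R : fieldType) (m : nat).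
Implicit Types p q d : {poly R}.

Definition congX p q := 'X^m %| p - q.

Lemma congXX p : congX p p.
Proof. by rewrite /congX subrr dvdp0. Qed.

Lemma congX_sym p q : congX p q -> congX q p.
Proof. by rewrite /congX -opprB dvdpNr. Qed.

Lemma congX_trans p q d : congX p q -> congX q d -> congX p d.
Proof. by rewrite /congX => /dvdp_add h /h; rewrite addrA subrK. Qed.

Lemma congXD p q p' q' : congX p q -> congX p' q' -> congX (p + p') (q + q').
Proof. by rewrite /congX => /dvdp_add h /h; rewrite opprD addrACA. Qed.

Lemma congXM p q p' q' : congX p q -> congX p' q' -> congX (p * p') (q * q').
Proof.
move=> pq pq'; rewrite /congX.
have -> : p * p' - q * q' = (p - q) * p' + q * (p' - q') by ring.
by apply: dvdp_add; [apply: dvdp_mulr | apply: dvdp_mull].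
Qed.

Lemma congX_sum (I : Type) (r : seq I) (P : pred I) (F G : I -> {poly R}) :
  (forall i, P i -> congX (F i) (G i)) ->
  congX (\sum_(i <- r | P i) F i) (\sum_(i <- r | P i) G i).
Proof. by move=> FG; elim/big_ind2: _ => [|*|//]; [apply: congXX|apply: congXD]. Qed.

Lemma congX_prod (I : Type) (r : seq I) (P : pred I) (F G : I -> {poly R}) :
  (forall i, P i -> congX (F i) (G i)) ->
  congX (\prod_(i <- r | P i) F i) (\prod_(i <- r | P i) G i).
Proof. by move=> FG; elim/big_ind2: _ => [|*|//]; [apply: congXX|apply: congXM]. Qed.

Lemma congX_sum0 (I : Type) (r : seq I) (P : pred I) (F : I -> {poly R}) :
  (forall i, P i -> congX (F i) 0) -> congX (\sum_(i <- r | P i) F i) 0.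
Proof. by move/(congX_sum r); rewrite big1_eq. Qed.

Lemma congX_prod1 (I : Type) (r : seq I) (P : pred I) (F : I -> {poly R}) :
  (forall i, P i -> congX (F i) 1) -> congX (\prod_(i <- r | P i) F i) 1.
Proof. by move/(congX_prod r); rewrite big1_eq. Qed.

Lemma congX_Xn k : (m <= k)%N -> congX 'X^k 0.
Proof. by rewrite /congX subr0; apply: dvdp_exp2l. Qed.

Lemma congX_1subXn k : (m <= k)%N -> congX (1 - 'X^k) 1.
Proof. by move=> ?; rewrite /congX addrAC subrr add0r dvdpNr dvdp_exp2l. Qed.

Lemma congX_coef p q k : congX p q -> (k < m)%N -> p`_k = q`_k.
Proof.
move=> /dvdpP[d pq] k_lt; apply/eqP.
by rewrite -subr_eq0 -coefB pq coefMXn k_lt.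
Qed.

(** A polynomial with nonzero constant term is coprime to ['X^m]; cancelling it stands for dividing
    power series. *)
Lemma congX_cancel d p q : ~~ root d 0 -> congX (d * p) (d * q) -> congX p q.
Proof.
move=> d0; rewrite /congX -mulrBr Gauss_dvdpr //.
by apply: coprimep_expl; rewrite coprimep_sym coprimepX.
Qed.

End CongruenceModX.

(** * Truncated Euler-type products, up to Gauss' identity in characteristic 2 *)

Section Series.
Local Open Scope ring_scope.

Lemma root_prod_1subXn (R : fieldType) (I : Type) (r : seq I) (P : pred I) (h : I -> nat) :
  (forall i, P i -> 0 < h i)%N ->
  ~~ root (\prod_(i <- r | P i) (1 - 'X^(h i)) : {poly R}) 0.
Proof.
move=> h_gt0; rewrite /root horner_prod big1 ?oner_neq0 // => i /h_gt0 hi.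
by rewrite !hornerE expr0n gtn_eqF // subr0.
Qed.

Lemma geometric_congX (R : fieldType) (n i : nat) : (0 < i)%N ->
  congX n.+1 ((1 - 'X^i) * \sum_(k < n.+1) 'X^(i * k)) (1 : {poly R}).
Proof.
move=> i_gt0; under eq_bigr do rewrite exprM.
have -> : (1 - 'X^i) * \sum_(k < n.+1) 'X^i ^+ k = 1 - 'X^(i * n.+1) :> {poly R}.
  by rewrite exprM -[RHS]opprB subrX1 -mulNr opprB.
by apply: congX_1subXn; apply: leq_pmull.
Qed.

(** Removing the term [k = 0] subtracts [1 - 'X^i] from 1. This is the factor of a part that must
    occur. *)
Lemma geometric_gt0_congX (R : fieldType) (n i : nat) : (0 < i)%N ->
  congX n.+1 ((1 - 'X^i) * \sum_(k < n.+1 | (0 < k)%N) 'X^(i * k)) ('X^i : {poly R}).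
Proof.
move=> i_gt0; have := geometric_congX R n i_gt0.
rewrite (bigD1 ord0) //= muln0 expr0 mulrDr mulr1 /congX.
under eq_bigl do rewrite -lt0n.
by congr (is_true (_ %| _)); ring.
Qed.

Lemma big_nat_reindex (R : Type) (idx : R) (op : Monoid.com_law idx)
    (h : nat -> nat) (N M : nat) (P Q : pred nat) (F : nat -> R) :
    injective h ->
    (forall i, (i < N)%N && P i <-> exists2 j, (j < M)%N && Q j & i = h j) ->
  \big[op/idx]_(0 <= i < N | P i) F i = \big[op/idx]_(0 <= j < M | Q j) F (h j).
Proof.
move=> h_inj PQ; rewrite -big_filter -[RHS]big_filter -[RHS](big_map h predT F).
apply: perm_big; apply: uniq_perm.
- by rewrite filter_uniq // iota_uniq.
- by rewrite map_inj_uniq // filter_uniq // iota_uniq.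
move=> i; rewrite mem_filter mem_index_iota andbC /=.
apply/idP/mapP => [/PQ[j Qj ->]|[j]].
  by exists j => //; rewrite mem_filter mem_index_iota andbC.
by rewrite mem_filter mem_index_iota /= andbC => Qj ->; apply/PQ; exists j.
Qed.

(** Since [j < h j], each exponent [h j <= n] arises from some [j < n]; the factors with [h j > n]
    are 1 modulo ['X^n.+1]. *)
Lemma prod_1subXn_reindex (R : fieldType) (n : nat) (h : nat -> nat) (P : pred nat) :
    injective h -> (forall j, j < h j)%N ->
    (forall i, P i <-> exists j, i = h j) ->
  congX n.+1 (\prod_(0 <= i < n.+1 | P i) (1 - 'X^i))
             (\prod_(0 <= j < n) (1 - 'X^(h j)) : {poly R}).
Proof.
move=> h_inj h_gt P_h.
rewrite (@big_nat_reindex _ _ _ h _ n _ (fun j => h j < n.+1)%N) //; last first.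
  move=> i; split=> [/andP[i_le /P_h[j i_h]]|[j /andP[_ hj ->]]].
    exists j => //; rewrite -i_h i_le andbT -ltnS (leq_trans _ i_le) // i_h.
    by rewrite ltnS.
  by rewrite hj; apply/P_h; exists j.
rewrite big_mkcond; apply: congX_prod => j _.
by case: ltnP => hj; [apply: congXX | apply/congX_sym/congX_1subXn].
Qed.

(** Squaring turns the exponents [2j+1] into [4j+2]; together with the [4j+4] these are all even
    exponents up to [4n]. *)
Lemma odd_prod_sqr (R : comNzRingType) (q : R) (n : nat) : 1 + 1 = 0 :> R ->
  odd_prod q n * (odd_prod q n * \prod_(0 <= j < n) (1 - q ^+ (j * 4).+4)) =
  even_prod q 0 (n * 2).
Proof.
move=> char2; rewrite /odd_prod /even_prod.
elim: n => [|n IHn]; first by rewrite !big_geq // !mul1r.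
rewrite mulSn !addSn add0n !big_nat_recr //= -IHn.
rewrite (_ : (n * 2 * 2).+2 = (n * 2).+1 * 2)%N; last by lia.
rewrite (_ : ((n * 2).+1 * 2).+2 = (n * 4).+4)%N; last by lia.
rewrite exprM; set a := q ^+ _; set b := q ^+ _.
have -> : 1 - a ^+ 2 = (1 - a) ^+ 2 + (1 + 1) * (a - a ^+ 2) by ring.
rewrite char2 mul0r addr0; ring.
Qed.

Lemma gauss_triangular_congX (R : fieldType) (t n : nat) : (0 < t)%N ->
    1 + 1 = 0 :> R ->
  congX n.+1 (odd_prod 'X^t n * \prod_(0 <= j < n) (1 - 'X^t ^+ (j * 4).+4))
             (\sum_(0 <= s < (n * 2).+1) 'X^t ^+ 'C(s.+1, 2) : {poly R}).
Proof.
move=> t_gt0 char2; set q : {poly R} := 'X^t.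
have char2X : 1 + 1 = 0 :> {poly R} by rewrite -polyCD char2.
apply: (@congX_cancel _ _ (odd_prod q n)).
  rewrite /odd_prod; under eq_bigr do rewrite -exprM.
  by apply: root_prod_1subXn => j _; rewrite muln_gt0 t_gt0.
rewrite odd_prod_sqr // shanks_identity.
(* The factors of index [j >= n] have exponent [t(2j+2) > n], hence are congruent to 1. *)
apply: (@congX_trans _ _ _ (even_prod q 0 n)).
  rewrite /even_prod (@big_cat_nat _ _ _ n) //=; last by lia.
  rewrite -[X in congX _ _ X]mulr1; apply: congXM; first exact: congXX.
  rewrite big_nat; apply: congX_prod1 => j /andP[j_ge _].
  by rewrite -exprM; apply: congX_1subXn; nia.
rewrite big_ltn //= mul0n expr0 mulr1.
rewrite [odd_prod q 0]/odd_prod big_geq // mulr1.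
(* The terms with [s > 0] vanish, as their exponent is at least [t(2n+1) > n]. *)
rewrite -[X in congX _ X _]addr0; apply: congXD; first exact: congXX.
rewrite big_nat; apply/congX_sym/congX_sum0 => s /andP[s_gt0 _].
rewrite -[X in congX _ _ X](mulr0 (even_prod q s n * odd_prod q s)).
by apply: congXM; rewrite -?exprM; [apply: congXX | apply: congX_Xn; nia].
Qed.

End Series.

(** * Partitions containing the first multiples of [t], and the series of [p_mex] *)

Section MexSide.
Variables (t n : nat).
Hypothesis t_gt0 : 0 < t.

(** The residue class of [t] modulo [t] is that of 0, so the mex is a positive multiple of [t], and
    minimality puts all smaller ones in [l]. *)
Lemma mex_multiple (l : seq nat) : all (fun i => i < n.+1) l ->
  exists m, [/\ mex t t_gt0 l = m.+1 * t, m * t <= n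
    & forall j, all (fun i => i.+1 * t \in l) (iota 0 j) = (j <= m)].
Proof.
move=> l_le; rewrite /mex; case: ex_minnP => x /and3P[x_gt0 /eqP x_mod x_notin] x_min.
have /dvdnP[[|m] x_eq] : t %| x by rewrite /dvdn x_mod modnn.
  by rewrite x_eq in x_gt0.
have mem_l i : i < m -> i.+1 * t \in l.
  move=> i_lt; apply: contraLR i_lt => i_notin; rewrite -leqNgt.
  have /x_min : mex_candidate t t l (i.+1 * t).
    by rewrite /mex_candidate muln_gt0 t_gt0 i_notin modnMl modnn eqxx.
  by rewrite x_eq leq_pmul2r.
exists m; split=> //.
  by case: m mem_l {x_eq} => // m /(_ m (ltnSn m)) /(allP l_le); rewrite ltnS.
move=> j; apply/allP/idP => [all_j|j_le i].
  rewrite leqNgt; apply/negP => m_lt; move/negP: x_notin; apply.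
  by rewrite x_eq all_j // mem_iota.
by rewrite mem_iota => i_lt; apply/mem_l/(leq_trans _ j_le).
Qed.

(** If the mex is [(m+1)t], the nonzero terms are those with [j <= m], all kept by the filter as
    [m * t <= n]. Their number [m+1] is odd exactly when [(m+1)t] is [t] modulo [2t]. *)
Lemma mex_indicator (l : seq nat) : all (fun i => i < n.+1) l ->
  ((mex t t_gt0 l == t %[mod 2 * t])%:R =
   \sum_(0 <= j < n.+1 | (j * t <= n)%N)
     (all (fun i => i.+1 * t \in l) (iota 0 j))%:R :> 'F_2)%R.
Proof.
move=> /mex_multiple[m [-> m_le all_m]].
have -> : (m.+1 * t == t %[mod 2 * t]) = ~~ odd m.
  rewrite -[X in _ == X %[mod _]]mul1n -!muln_modl eqn_pmul2r // !modn2 /=.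
  by case: (odd m).
under eq_bigr do rewrite all_m.
rewrite -natr_sum -big_mkcondr /=.
rewrite (_ : \sum_(0 <= j < n.+1 | _) 1 = m.+1); last first.
  rewrite -[RHS]subn0 -[RHS]muln1 -sum_nat_const_nat.
  have m_le_n : m <= n by apply: leq_trans m_le; apply: leq_pmulr.
  rewrite [RHS](big_nat_widen _ _ n.+1) //; apply: eq_bigl => j /=.
  by rewrite ltnS andbC; case: leqP => // j_le; apply/(leq_trans _ m_le)/leq_mul.
by apply/val_inj; rewrite /= !val_Fp_nat // !modn2 /=; case: (odd m).
Qed.

Definition geq_ord (x y : 'I_n.+1) := geq x y.

(** The alphabet ['I_n.+1] contains 0, which is not a part; the second clause forces [t], ..., [jt]
    to occur. *)
Definition mex_mult (j : nat) (i : 'I_n.+1) (k : nat) :=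
  ((i == 0 :> nat) ==> (k == 0)) && ([&& 0 < i, t %| i & i <= j * t] ==> (0 < k)).

Lemma mem_mex_words j (s : n.-bseq 'I_n.+1) : j * t <= n ->
  (s \in sorted_words geq_ord val (mex_mult j) n) =
  is_partition n (map val s) && all (fun i => i.+1 * t \in map val s) (iota 0 j).
Proof.
move=> j_le; rewrite inE /is_partition sorted_map -!andbA; congr andb.
rewrite [RHS]andbCA; congr andb.
apply/forallP/andP => [c_s|[/allP pos_s /allP all_s] x].
  split; apply/allP.
    move=> _ /mapP[x x_s ->]; have /andP[+ _] := c_s x.
    rewrite -implybNN -!lt0n -has_count has_pred1 => /implyP; exact.
  move=> i; rewrite mem_iota /= => i_lt.
  (* The bound [j * t <= n] makes each forced multiple a letter of the alphabet. *)
  have i_le : i.+1 * t < n.+1 by rewrite ltnS (leq_trans _ j_le) // leq_mul2r i_lt orbT.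
  have /andP[_] := c_s (Ordinal i_le).
  rewrite /= muln_gt0 t_gt0 dvdn_mull // leq_mul2r i_lt orbT /= -has_count has_pred1.
  by move/(map_f val).
rewrite /mex_mult -implybNN -!lt0n -has_count has_pred1.
apply/andP; split; apply/implyP; first by move/(map_f val)/pos_s.
case/and3P=> x_gt0 /dvdnP[[|i] x_eq] x_le; first by rewrite x_eq in x_gt0.
have : val x \in map val s.
  rewrite [val x]x_eq; apply: all_s.
  by move: x_le; rewrite x_eq leq_pmul2r // mem_iota.
by rewrite mem_map //; apply: val_inj.
Qed.

Local Open Scope ring_scope.

Definition mex_series (R : fieldType) : {poly R} :=
  \sum_(0 <= j < n.+1 | (j * t <= n)%N)
    \prod_(i < n.+1) \sum_(k < n.+1 | mex_mult j i k) 'X^(i * k).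

(** Double counting of pairs of an index [j] and a partition: summed over [j] first, each partition
    contributes its indicator. *)
Lemma p_mex_coef : (p_mex t t t_gt0 n)%:R = (mex_series 'F_2)`_n.
Proof.
rewrite /p_mex coef_sum -sum1dep_card natr_sum big_mkcondr /=.
under [RHS]eq_bigr => j j_le.
  rewrite -(@card_sorted_words_coef _ geq_ord val); first last.
  - by move=> i k /andP[/implyP ck _] /eqP/ck/eqP.
  - by move=> x y; rewrite /geq_ord andbC -eqn_leq => /eqP/val_inj.
  - by move=> y x z /= xy yz; apply: leq_trans xy.
  - by move=> x y; apply: leq_total.
  rewrite -sum1_card natr_sum.
  under eq_bigl do rewrite mem_mex_words //.
  rewrite big_mkcondr /=.
  over.
rewrite exchange_big /=; apply: eq_bigr => s /is_partition_bound[_ s_le].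
transitivity ((mex t t_gt0 (map val s) == t %[mod 2 * t])%:R : 'F_2); first by case: eqP.
by rewrite mex_indicator //; apply: eq_bigr => j _; case: all.
Qed.

Definition euler_prod (R : fieldType) : {poly R} :=
  \prod_(i < n.+1 | (0 < i)%N) (1 - 'X^i).

(** The Euler factors cancel the geometric sums and leave ['X^i] for each forced part; the exponents
    [t], ..., [jt] add up to [t] times a triangular number. *)
Lemma mex_series_congX (R : fieldType) :
  congX n.+1 (euler_prod R * mex_series R)
    (\sum_(0 <= s < (n * 2).+1) 'X^t ^+ 'C(s.+1, 2)).
Proof.
rewrite /mex_series mulr_sumr.
apply: (@congX_trans _ _ _
  (\sum_(0 <= j < n.+1 | (j * t <= n)%N) 'X^t ^+ 'C(j.+1, 2))); last first.
  (* The added indices satisfy [j * t > n] or [j > n], and ['C(j.+1, 2) >= j] then puts their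
     exponents above [n]. *)
  rewrite (@big_nat_widen _ _ _ _ n.+1 (n * 2).+1); last by lia.
  rewrite big_mkcond; apply: congX_sum => j _.
  case: ifPn => [_|j_gt]; first exact: congXX.
  rewrite -exprM; apply/congX_sym/congX_Xn.
  have C_ge : (j <= 'C(j.+1, 2))%N by rewrite binS bin1 leq_addl.
  by nia.
apply: congX_sum => j j_le.
rewrite /euler_prod big_mkcond -big_split /=.
have -> : 'X^t ^+ 'C(j.+1, 2) =
    \prod_(i < n.+1 | [&& 0 < i, t %| i & i <= j * t]%N) ('X^i : {poly R}).
  rewrite -(big_mkord (fun i => [&& 0 < i, t %| i & i <= j * t]%N) (fun i => 'X^i)).
  rewrite (@big_nat_reindex _ _ _ (fun m => m.+1 * t)%N _ j _ predT); last first.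
  - move=> i; split=> [|[m]].
      case/andP=> _ /and3P[i_gt0 /dvdnP[[|m] i_eq]]; first by rewrite i_eq in i_gt0.
      by rewrite i_eq leq_pmul2r // => m_lt; exists m; rewrite ?m_lt.
    rewrite andbT => m_lt ->; rewrite ltnS muln_gt0 t_gt0 dvdn_mull //=.
    by rewrite leq_pmul2r // m_lt andbT (leq_trans _ j_le) // leq_pmul2r.
  - by move=> m m' /eqP; rewrite eqn_pmul2r // => /eqP[].
  by rewrite prodrXr -big_distrl /= -exprM -bin2_sum big_nat_recl //= add0n mulnC.
rewrite [X in congX _ _ X]big_mkcond; apply: congX_prod => i _.
rewrite /mex_mult; case: (posnP i) => [i0|i_gt0] /=.
  rewrite mul1r (bigD1 ord0) //= i0 mul0n expr0 big1 ?addr0; first exact: congXX.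
  by move=> k /andP[/andP[/eqP k0 _]]; case/eqP; apply: val_inj.
case: ifP => _ /=; last exact: geometric_congX.
exact: geometric_gt0_congX.
Qed.

End MexSide.

(** * Singular overpartitions as sorted words, and the series of [Cbar] *)

Lemma all_count (T : finType) (a : pred T) (s : seq T) :
  all a s = [forall x, (0 < count_mem x s) ==> a x].
Proof.
apply/allP/forallP => a_s x; have := a_s x; rewrite -has_count has_pred1.
  by move/implyP.
by move/implyP.
Qed.

Lemma count_le1_pairwise (T : finType) (a : pred T) (s : seq T) :
  [forall x, a x ==> (count_mem x s <= 1)] =
  pairwise (fun x y => ~~ ((x == y) && a x)) s.
Proof.
elim: s => [|y s IHs] /=; first by apply/forallP=> x; rewrite implybT.
rewrite -IHs; apply/forallP/andP => [count_ys|[/allP y_s /forallP count_s] x].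
  split; last first.
    apply/forallP=> x; apply/implyP=> /(implyP (count_ys x)).
    by apply: leq_trans; apply: leq_addl.
  apply/allP=> x x_s; apply/negP=> /andP[/eqP y_x a_y].
  have := implyP (count_ys y) a_y; rewrite eqxx add1n ltnS leqn0 => /eqP/count_memPn.
  by rewrite y_x x_s.
apply/implyP=> a_x; case: eqP => [y_x|_]; last exact: (implyP (count_s x)).
rewrite (count_memPn _) //; apply/negP=> x_s; have := y_s x x_s.
by rewrite y_x eqxx a_x.
Qed.

(** A condition on pairs of entries can be merged with sortedness, itself pairwise for a transitive
    order. *)
Lemma overline_first_pairwise (l : seq (nat * bool)) :
  [forall j : 'I_(size l), (nth (0, false) l j).2 ==>
     ((nth (0, false) l j).1 \notin take j (unzip1 l))] =
  pairwise (fun x y => y.2 ==> (x.1 != y.1)) l.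
Proof.
apply/forallP/(pairwiseP (0, false)) => [first_l i j i_lt j_lt ij|pair_l j].
  have := first_l (Ordinal (j_lt : j < size l)); case: (_.2) => //=.
  apply: contra => /eqP <-; rewrite -(nth_map _ 0) //.
  by rewrite -(nth_take 0 ij) mem_nth // size_takel ?size_map // ltnW.
apply/implyP=> over_j; apply/negP=> /(nthP 0)[i].
rewrite size_takel ?size_map; last exact: ltnW.
move=> ij; rewrite nth_take // (nth_map (0, false)); last exact: ltn_trans ij _.
have := pair_l i j (ltn_trans ij (ltn_ord j)) (ltn_ord j) ij.
by rewrite over_j /= => /eqP.
Qed.

Section OverpartitionSide.
Variables (t n : nat).
Hypothesis t_gt0 : 0 < t.

(* For this total order the overpartitions are the sorted words in which every
   overlined letter occurs at most once. *)
Definition geq_over (x y : 'I_n.+1 * bool) :=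
  (y.1 < x.1) || ((x.1 == y.1) && (y.2 ==> x.2)).

Lemma geq_over_trans : transitive geq_over.
Proof.
move=> [y b] [x a] [z c]; rewrite /geq_over /=.
case/orP=> [yx|/andP[/eqP-> ab]].
  case/orP=> [zy|/andP[/eqP<- _]]; last by rewrite yx.
  by rewrite (ltn_trans zy yx).
case/orP=> [->//|/andP[-> bc]].
by apply/orP; right; apply/implyP=> /(implyP bc)/(implyP ab).
Qed.

Definition pm_class (i : nat) := (i == t %[mod 4 * t]) || (4 * t %| i + t).

(** The part 0 is excluded by the first clause, being a multiple of [4 * t]. *)
Definition over_mult (x : 'I_n.+1 * bool) (k : nat) :=
  [&& (0 < k) ==> ~~ (4 * t %| x.1), (0 < k) ==> x.2 ==> pm_class x.1
    & x.2 ==> (k <= 1)].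

Lemma mem_over_words (s : n.-bseq ('I_n.+1 * bool)) :
  (s \in sorted_words geq_over (fun x => val x.1) over_mult n) =
  (let s' := [seq (val x.1, x.2) | x <- s] in
   is_overpartition n s' && is_singular (4 * t) t s').
Proof.
rewrite inE /= /is_overpartition /is_partition /is_singular overline_first_pairwise.
have geqT : transitive geq by move=> y x z /= xy yz; apply: leq_trans xy.
have -> : [forall x, over_mult x (count_mem x s)] =
    [&& all (fun x : 'I_n.+1 * bool => ~~ (4 * t %| x.1)) s,
        all (fun x : 'I_n.+1 * bool => x.2 ==> pm_class x.1) s
      & pairwise (fun x y => ~~ ((x == y) && x.2)) s].
  rewrite !all_count -count_le1_pairwise.
  apply/forallP/and3P => [c_s|[/forallP c1 /forallP c2 /forallP c3] x].
    by split; apply/forallP=> x; case/and3P: (c_s x).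
  by apply/and3P.
(* For two equal parts, both sides say that the later one is not overlined. *)
have pairwiseE : pairwise geq_over s && pairwise (fun x y => ~~ ((x == y) && x.2)) s =
    pairwise (fun x y : 'I_n.+1 * bool => y.1 <= x.1) s && 
    pairwise (fun x y : 'I_n.+1 * bool => y.2 ==> (x.1 != y.1 :> nat)) s.
  rewrite -!pairwise_relI; apply: eq_pairwise => -[x a] [y b] /=.
  rewrite /geq_over /= xpair_eqE -val_eqE /=.
  by case: (ltngtP x y) => //=; case: a b => [] [].
rewrite /unzip1 -map_comp !sorted_pairwise //; last exact: geq_over_trans.
rewrite !pairwise_map !all_map.
have [nmul|] := boolP (all (fun x : 'I_n.+1 * bool => ~~ (4 * t %| x.1)) s); last first.
  by rewrite !andbF.
rewrite [all (preim _ (leq 1)) s](_ : _ = true); last first.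
  apply/allP=> x /(allP nmul); rewrite /= lt0n; apply: contraNneq => ->.
  exact: dvdn0.
set sum_s := sumn _ == n; set class_s := all _ s.
transitivity ((pairwise geq_over s &&
    pairwise (fun x y => ~~ ((x == y) && x.2)) s) && (sum_s && class_s)).
  by case: (pairwise geq_over s); case: sum_s; case: class_s; rewrite /= ?andbF ?andbT.
rewrite pairwiseE /=; set p1 := pairwise _ s; set p2 := pairwise _ s.
by rewrite -[RHS]/(((p1 && sum_s) && p2) && class_s) -!andbA; congr andb; rewrite andbCA.
Qed.

Local Open Scope ring_scope.

Definition over_series (R : fieldType) : {poly R} :=
  \prod_x \sum_(k < n.+1 | over_mult x k) 'X^(x.1 * k).

Lemma Cbar_coef : (Cbar (4 * t) t n)%:R = (over_series 'F_2)`_n.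
Proof.
rewrite -(@card_sorted_words_coef _ geq_over (fun x => val x.1)).
- by congr (_%:R); apply: eq_card => s; rewrite mem_over_words inE.
- move=> [x a] [y b]; rewrite /geq_over /= -!val_eqE /=.
  by case: (ltngtP x y) => //= _; case: a b => [] [].
- exact: geq_over_trans.
- move=> [x a] [y b]; rewrite /geq_over /= -!val_eqE /=.
  by case: (ltngtP x y) => //= /val_inj->; case: a b => [] [].
- by move=> x k /andP[+ _] x0; rewrite x0 dvdn0; case: k.
Qed.

(** Modulo [4t], the classes of [t] and [-t = 3t] together form the odd multiples of [t]. *)
Lemma pm_classP i : pm_class i <-> exists j, i = (t * (j * 2).+1)%N.
Proof.
rewrite /pm_class; split=> [/orP[/eqP|/dvdnP[[|a] i_eq]]|[j ->]].
- rewrite [X in _ = X]modn_small; last by lia.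
  move=> i_mod; exists (i %/ (4 * t) * 2)%N.
  by rewrite {1}(divn_eq i (4 * t)) i_mod; lia.
- by lia.
- by exists (a * 2).+1; lia.
have := odd_double_half j; move: j./2 => a; case: (odd j) => /= <-; last first.
  rewrite (_ : t * _ = a * (4 * t) + t)%N; last by lia.
  by rewrite modnMDl eqxx.
by apply/orP; right; apply/dvdnP; exists a.+1; lia.
Qed.

(** An overlined letter of admissible part [i] contributes [1 + 'X^i], which is [1 - 'X^i] here. A
    plain letter contributes a geometric sum, cancelled by its Euler factor, unless [4t] divides
    [i]; then that Euler factor survives. *)
Lemma over_series_congX (R : fieldType) : 1 + 1 = 0 :> R ->
  congX n.+1 (euler_prod n R * over_series R)
    (odd_prod 'X^t n * \prod_(0 <= j < n) (1 - 'X^t ^+ (j * 4).+4)).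
Proof.
move=> char2; pose mul4 i := (0 < i)%N && (4 * t %| i)%N.
have pos_mul4 i : (0 < i)%N -> mul4 i = (4 * t %| i)%N by rewrite /mul4 => ->.
have subXE i : 1 - 'X^i = 1 + 'X^i :> {poly R}.
  apply/eqP; rewrite -subr_eq0 (_ : _ - _ = - ((1 + 1) * 'X^i)); last by ring.
  by rewrite -polyCD char2 mul0r oppr0.
have pm_mul4 i : pm_class i -> (0 < i)%N && ~~ (4 * t %| i)%N.
  move=> /pm_classP[j ->]; rewrite muln_gt0 t_gt0 /= mulnC dvdn_pmul2l //.
  by rewrite /dvdn; apply/eqP; lia.
apply: (@congX_trans _ _ _ ((\prod_(i < n.+1 | pm_class i) (1 - 'X^i)) *
    \prod_(i < n.+1 | mul4 i) (1 - 'X^i))); last first.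
  apply: congXM.
    rewrite -(big_mkord pm_class (fun i => 1 - 'X^i)) /odd_prod.
    under [X in congX _ _ X]eq_bigr do rewrite -exprM.
    apply: prod_1subXn_reindex pm_classP.
      by move=> j j' /eqP; rewrite eqn_pmul2l // => /eqP; lia.
    by move=> j; nia.
  rewrite -(big_mkord mul4 (fun i => 1 - 'X^i)).
  under [X in congX _ _ X]eq_bigr do rewrite -exprM.
  apply: prod_1subXn_reindex.
  - by move=> j j' /eqP; rewrite eqn_pmul2l // => /eqP; lia.
  - by move=> j; nia.
  move=> i; split=> [/andP[i_gt0 /dvdnP[[|j] i_eq]]|[j ->]].
  - by rewrite i_eq in i_gt0.
  - by exists j; lia.
  by rewrite /mul4 muln_gt0 t_gt0 /=; apply/dvdnP; exists j.+1; lia.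
rewrite /euler_prod /over_series (eq_bigr (fun x => (fun i b =>
  \sum_(k < n.+1 | over_mult (i, b) k) ('X^(i * k) : {poly R})) x.1 x.2)); last by case.
rewrite -(pair_bigA _ (fun i b =>
  \sum_(k < n.+1 | over_mult (i, b) k) ('X^(i * k) : {poly R}))) /=.
rewrite big_mkcond [\prod_(i < n.+1 | pm_class i) _]big_mkcond.
rewrite [\prod_(i < n.+1 | mul4 i) _]big_mkcond -!big_split /=.
apply: congX_prod => i _.
rewrite big_bool mulrCA; apply: congXM.
  rewrite [X in congX _ X _](_ : _ = if pm_class i then 1 - 'X^i else 1).
    exact: congXX.
  case: ifPn => [i_pm|i_npm].
    have [i_gt0 i_nmul] := andP (pm_mul4 i i_pm).
    rewrite (eq_bigl (fun k : 'I_n.+1 => k <= 1)%N); last first.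
      by move=> k; rewrite /over_mult /= i_pm i_nmul !implybT.
    (* As [0 < i <= n], the multiplicity 1 lies within the range [k < n.+1]. *)
    have n_gt0 : (0 < n)%N by apply: leq_trans i_gt0 _; rewrite -ltnS.
    rewrite -(big_mkord (fun k => k <= 1)%N (fun k => 'X^(i * k))) subXE.
    have -> : \sum_(0 <= k < n.+1 | (k <= 1)%N) 'X^(i * k) =
        \sum_(0 <= k < 2) 'X^(i * k) :> {poly R}.
      by rewrite [RHS](@big_nat_widen _ _ _ _ _ n.+1).
    by rewrite big_nat_recr // big_nat1 /= muln0 muln1.
  rewrite (big_pred1 ord0) ?muln0 // => k.
  by rewrite /over_mult /= (negPf i_npm) -val_eqE /=; case: (val k) => //= *; rewrite andbF.
case: (posnP i) => [i0|i_gt0].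
  rewrite /mul4 i0 mul1r (big_pred1 ord0) ?muln0 ?expr0; first exact: congXX.
  by move=> k; rewrite /over_mult /= i0 dvdn0 -val_eqE /=; case: (val k).
rewrite pos_mul4 //; case: ifPn => i_mul.
  rewrite (big_pred1 ord0) ?muln0 ?expr0 ?mulr1; first exact: congXX.
  by move=> k; rewrite /over_mult /= i_mul -val_eqE /=; case: (val k).
rewrite (eq_bigl predT); first exact: geometric_congX.
by move=> k; rewrite /over_mult /= i_mul !implybT.
Qed.


End OverpartitionSide.

Theorem theorem3p1 (t : nat) (t_gt0 : 0 < t) (n : nat) :
  p_mex t t t_gt0 n = Cbar (4 * t) t n %[mod 2].
Proof.
suff : ((p_mex t t t_gt0 n)%:R = (Cbar (4 * t) t n)%:R :> 'F_2)%R.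
  by move/(congr1 val); rewrite /= !val_Fp_nat.
rewrite p_mex_coef Cbar_coef //.
apply: (@congX_coef _ n.+1) => //.
apply: (@congX_cancel _ _ (euler_prod n _)).
  by rewrite /euler_prod root_prod_1subXn.
have char2 : (1 + 1 = 0 :> 'F_2)%R by apply: val_inj.
apply: congX_trans (mex_series_congX n t_gt0 _) _; apply: congX_sym.
apply: congX_trans (over_series_congX n t_gt0 char2) _.
exact: gauss_triangular_congX.
Qed.
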